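(* Let $G_1=(V_1,E_1)$ and $G_2=(V_2,E_2)$ be graphs. Then $f(G_1\ltimes G_2)\leq f(G_1)|V_2|$ for each $f\in\{\mathrm{thin},\mathrm{pthin},\mathrm{compthin},\mathrm{comppthin},\mathrm{indthin},\mathrm{indpthin}\}$.
   Context: Graphs are finite, simple, undirected (loopless). The homomorphic product $G_1\ltimes G_2$ has vertex set $V_1\times V_2$, and distinct vertices $(u_1,u_2)$, $(v_1,v_2)$ are adjacent iff either $u_1=v_1$, or ($u_1v_1\in E_1$ and $u_2v_2\notin E_2$). For a graph $G=(V,E)$, an ordering $v_1,\dots,v_n$ of $V$ and a partition of $V$ are consistent if for every $r<s<t$, whenever $v_r,v_s$ are in the same class and $v_tv_r\in E$, then $v_tv_s\in E$; strongly consistent if moreover for every $r<s<t$, whenever $v_s,v_t$ are in the same class and $v_tv_r\in E$, then $v_sv_r\in E$. $\mathrm{thin}(G)$ (resp. $\mathrm{pthin}(G)$) is the minimum number of classes of a partition of $V$ consistent (resp. strongly consistent) with some ordering of $V$. $\mathrm{indthin}$, $\mathrm{indpthin}$ are defined likewise requiring each class to be an independent set, and $\mathrm{compthin}$, $\mathrm{comppthin}$ requiring each class to be a clique. *)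

(* Defs.v *)
From mathcomp Require Import all_boot.

Set Implicit Arguments.
Unset Strict Implicit.
Unset Printing Implicit Defensive.

Record sgraph := SGraph {
  svertex :> finType;
  sedge : rel svertex;
  sedge_sym : symmetric sedge;
  sedge_irrefl : irreflexive sedge }.

Notation "x -- y" := (sedge x y) (at level 30, y at next level).

Section HomProduct.
Variables G1 G2 : sgraph.

Definition hom_prod_rel : rel (G1 * G2) := fun u v =>
  (u != v) && ((u.1 == v.1) || ((u.1 -- v.1) && ~~ (u.2 -- v.2))).

Lemma hom_prod_sym : symmetric hom_prod_rel.
Proof.
move=> u v; rewrite /hom_prod_rel eq_sym (eq_sym u.1).
by rewrite (sedge_sym u.1) (sedge_sym u.2).
Qed.

Lemma hom_prod_irrefl : irreflexive hom_prod_rel.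
Proof. by move=> u; rewrite /hom_prod_rel eqxx. Qed.

Definition hom_prod : sgraph :=
  @SGraph (G1 * G2)%type hom_prod_rel hom_prod_sym hom_prod_irrefl.

End HomProduct.

Section Thinness.
Variable G : sgraph.

Implicit Types (v : {ffun 'I_#|G| -> G}) (P : {set {set G}}) (C : {set G}).

(* Injectivity suffices for v to enumerate G, the two cardinals being equal. *)
Definition is_ordering v : bool := injectiveb v.

Definition same_class P (x y : G) : bool :=
  [exists C in P, (x \in C) && (y \in C)].

Definition consistent v P : bool :=
  [forall r : 'I_#|G|, forall s : 'I_#|G|, forall t : 'I_#|G|,
    [&& r < s, s < t, same_class P (v r) (v s) & v t -- v r] ==>
    (v t -- v s)].

Definition strongly_consistent v P : bool :=
  consistent v P &&
  [forall r : 'I_#|G|, forall s : 'I_#|G|, forall t : 'I_#|G|,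
    [&& r < s, s < t, same_class P (v s) (v t) & v t -- v r] ==>
    (v s -- v r)].

Definition any_class C : bool := true.

Definition independent C : bool :=
  [forall x in C, forall y in C, ~~ (x -- y)].

Definition clique C : bool :=
  [forall x in C, forall y in C, (x != y) ==> (x -- y)].

Definition has_partition (cns : {ffun 'I_#|G| -> G} -> {set {set G}} -> bool)
    (cls : {set G} -> bool) : pred nat := fun k =>
  [exists v, exists P,
    [&& is_ordering v, partition P [set: G], cns v P,
        [forall C in P, cls C] & #|P| == k]].

Definition singletons : {set {set G}} := [set [set x] | x : G].

Lemma same_class_singletons x y : same_class singletons x y -> x = y.
Proof.
by case/existsP=> C /and3P[/imsetP[z _ ->]]; rewrite !inE => /eqP-> /eqP->.
Qed.

Lemma singletons_strong v : is_ordering v -> strongly_consistent v singletons.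
Proof.
move/injectiveP=> inj_v; apply/andP; split;
  apply/forallP=> r; apply/forallP=> s; apply/forallP=> t; apply/implyP;
  case/and4P=> rs st /same_class_singletons/inj_v E _.
- by rewrite E ltnn in rs.
- by rewrite E ltnn in st.
Qed.

Lemma singletons_consistent v : is_ordering v -> consistent v singletons.
Proof. by move/singletons_strong/andP=> []. Qed.

Lemma ex_partition (cns : {ffun 'I_#|G| -> G} -> {set {set G}} -> bool)
    (cls : {set G} -> bool) :
    (forall v, is_ordering v -> cns v singletons) ->
    (forall x, cls [set x]) ->
  exists k, has_partition cns cls k.
Proof.
move=> cnsP clsP; exists #|singletons|.
have ord_v : is_ordering [ffun i : 'I_#|G| => enum_val i].
  by apply/injectiveP=> i j; rewrite !ffunE => /enum_val_inj.
apply/existsP; exists [ffun i => enum_val i].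
apply/existsP; exists singletons.
rewrite ord_v cnsP // eqxx andbT /=; apply/andP; split; last first.
  by apply/forallP=> C; apply/implyP=> /imsetP[x _ ->].
apply/and3P; split.
- apply/eqP/setP=> x; rewrite inE; apply/bigcupP.
  by exists [set x]; rewrite ?set11 // imset_f.
- apply/trivIsetP=> _ _ /imsetP[x _ ->] /imsetP[y _ ->] ne_xy.
  by rewrite disjoints1 inE; apply: contraNN ne_xy => /eqP->.
- by apply/imsetP=> -[x _ /setP/(_ x)]; rewrite !inE eqxx.
Qed.

Lemma any_class1 x : any_class [set x].
Proof. by []. Qed.

Lemma independent1 x : independent [set x].
Proof.
apply/forallP=> y; apply/implyP=> /set1P->; apply/forallP=> z.
by apply/implyP=> /set1P->; rewrite sedge_irrefl.
Qed.

Lemma clique1 x : clique [set x].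
Proof.
apply/forallP=> y; apply/implyP=> /set1P->; apply/forallP=> z.
by apply/implyP=> /set1P->; rewrite eqxx.
Qed.

Definition thin : nat :=
  ex_minn (ex_partition singletons_consistent any_class1).
Definition pthin : nat :=
  ex_minn (ex_partition singletons_strong any_class1).
Definition indthin : nat :=
  ex_minn (ex_partition singletons_consistent independent1).
Definition indpthin : nat :=
  ex_minn (ex_partition singletons_strong independent1).
Definition compthin : nat :=
  ex_minn (ex_partition singletons_consistent clique1).
Definition comppthin : nat :=
  ex_minn (ex_partition singletons_strong clique1).

End Thinness.

(* Main.v *)
Require Import Defs.
From mathcomp Require Import all_boot.

(** Order [V1 * V2] so that the first coordinates follow an optimal ordering of
    [G1], ties being broken arbitrarily, and split every class [C] of an optimal
    partition of [G1] into the classes [C * {w}], for [w] in [V2]. Two vertices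
    of one class agree on the second coordinate, so a third vertex is related to
    both in the same way as far as [G2] is concerned; if its first coordinate
    coincides with one of theirs then it is adjacent to that vertex outright, and
    otherwise the three first coordinates are strictly ordered, so that the
    consistency of the ordering of [G1] applies. *)

Lemma exists_monotone_enumeration (T : finType) (f : T -> nat) :
  exists2 v : {ffun 'I_#|T| -> T}, injective v &
    forall i j : 'I_#|T|, i < j -> f (v i) <= f (v j).
Proof.
pose s := sort (relpre f leq) (enum T).
have size_s : size s == #|T| by rewrite size_sort -cardE.
have uniq_s : uniq s by rewrite sort_uniq enum_uniq.
have sorted_s : sorted (relpre f leq) s by apply: sort_sorted => x y; apply: leq_total.
have trans_f : transitive (relpre f leq) by move=> y x z; apply: leq_trans.
exists [ffun i => tnth (Tuple size_s) i] => [i j|i j lt_ij]; rewrite !ffunE.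
  by move/tuple_uniqP: (uniq_s : uniq (Tuple size_s)); apply.
(* [T] may be empty, so the default element for [nth] is drawn from the index [i]. *)
have x0 : T := tnth (Tuple size_s) i.
rewrite !(tnth_nth x0) /=.
by apply: (sorted_ltn_nth trans_f x0 sorted_s); rewrite ?inE ?(eqP size_s).
Qed.

Lemma ordering_surj {G : sgraph} (v : {ffun 'I_#|G| -> G}) (x : G) :
  is_ordering v -> exists i, x = v i.
Proof.
move/injectiveP=> inj_v; have [|g _ vK] := inj_card_bij inj_v; first by rewrite card_ord.
by exists (g x); rewrite vK.
Qed.

(** Positions in [v1] are given by equations, which avoids fixing an inverse of [v1]; the weak
    inequality leaves room for ties between equal first coordinates. *)
Definition refines_fst {G1 G2 : sgraph} (v1 : {ffun 'I_#|G1| -> G1})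
    (v : {ffun 'I_#|hom_prod G1 G2| -> hom_prod G1 G2}) : Prop :=
  forall (i j : 'I_#|hom_prod G1 G2|) (i1 j1 : 'I_#|G1|),
    i < j -> (v i).1 = v1 i1 -> (v j).1 = v1 j1 -> i1 <= j1.

Lemma exists_refining_ordering (G1 G2 : sgraph) (v1 : {ffun 'I_#|G1| -> G1}) :
  is_ordering v1 ->
  exists2 v : {ffun 'I_#|hom_prod G1 G2| -> hom_prod G1 G2},
    is_ordering v & refines_fst v1 v.
Proof.
move/injectiveP=> inj_v1; have [|g v1K _] := inj_card_bij inj_v1; first by rewrite card_ord.
(* As [g] inverts [v1], the sorting key [g u.1] is the position of the first coordinate in [v1]. *)
have [v inj_v mono_v] := exists_monotone_enumeration
  (hom_prod G1 G2) (fun u : G1 * G2 => g u.1 : nat).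
exists v; first exact/injectiveP.
by move=> i j i1 j1 /mono_v + vi vj; rewrite vi vj !v1K.
Qed.

Definition split_classes {G1 : sgraph} (G2 : sgraph) (P : {set {set G1}}) :
    {set {set hom_prod G1 G2}} :=
  [set setX C [set w] | C in P, w in [set: G2]].

Lemma split_classesP {G1 G2 : sgraph} (P : {set {set G1}}) (D : {set hom_prod G1 G2}) :
  reflect (exists C w, C \in P /\ D = setX C [set w]) (D \in split_classes G2 P).
Proof.
apply: (iffP imset2P) => [[C w PC _ ->]|[C [w [PC ->]]]]; first by exists C, w.
by exists C w.
Qed.

Lemma card_split_classes {G1 : sgraph} (G2 : sgraph) (P : {set {set G1}}) :
  #|split_classes G2 P| <= #|P| * #|G2|.
Proof.
rewrite /split_classes curry_imset2X -[#|G2|]cardsT -cardsX.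
exact: leq_imset_card.
Qed.

Lemma partition_split_classes {G1 G2 : sgraph} (P : {set {set G1}}) :
  partition P [set: G1] -> partition (split_classes G2 P) [set: hom_prod G1 G2].
Proof.
case/and3P=> /eqP covP /trivIsetP tiP P0; apply/and3P; split.
- apply/eqP/setP=> -[x w]; rewrite inE; apply/bigcupP.
  have /bigcupP[C PC xC] : x \in cover P by rewrite covP inE.
  exists (setX C [set w]); last by rewrite !inE xC eqxx.
  by apply/split_classesP; exists C, w.
- apply/trivIsetP=> _ _ /split_classesP[C [w [PC ->]]] /split_classesP[D [z [PD ->]]] neq.
  (* A common element [(x, y)] forces [w = z = y], and [x] then lies in both [C] and [D], so these
     coincide. *)
  rewrite -setI_eq0; apply: contraNT neq => /set0Pn[[x y]].
  rewrite !inE /= => /andP[/andP[xC /eqP<-] /andP[xD /eqP<-]].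
  have [->//|/(tiP _ _ PC PD)] := eqVneq C D.
  by move/disjointFr/(_ xC); rewrite xD.
- apply/negP=> /split_classesP[C [w [PC E]]].
  have /set0Pn[x xC] : C != set0 by apply: contraNneq P0 => <-.
  by move/setP/(_ (x, w)): E; rewrite !inE xC eqxx.
Qed.

Lemma same_class_split {G1 G2 : sgraph} (P : {set {set G1}}) (x y : hom_prod G1 G2) :
  same_class (split_classes G2 P) x y -> same_class P x.1 y.1 /\ x.2 = y.2.
Proof.
case/existsP=> _ /and3P[/split_classesP[C [w [PC ->]]]].
case: x y => [x1 x2] [y1 y2]; rewrite !inE /= => /andP[xC /eqP->] /andP[yC /eqP->].
by split=> //; apply/existsP; exists C; rewrite PC xC yC.
Qed.

Lemma refines_fst_lt {G1 G2 : sgraph} (v1 : {ffun 'I_#|G1| -> G1})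
    (v : {ffun 'I_#|hom_prod G1 G2| -> hom_prod G1 G2})
    (i j : 'I_#|hom_prod G1 G2|) (i1 j1 : 'I_#|G1|) :
  refines_fst v1 v -> i < j -> (v i).1 = v1 i1 -> (v j).1 = v1 j1 ->
  (v i).1 != (v j).1 -> i1 < j1.
Proof.
move=> ref_v lt_ij vi vj neq; rewrite ltn_neqAle (ref_v _ _ _ _ lt_ij vi vj) andbT.
by apply: contraNneq neq => E; rewrite vi vj (val_inj E).
Qed.

Lemma consistent_split {G1 G2 : sgraph} (v1 : {ffun 'I_#|G1| -> G1})
    (v : {ffun 'I_#|hom_prod G1 G2| -> hom_prod G1 G2}) (P : {set {set G1}}) :
  is_ordering v1 -> is_ordering v -> refines_fst v1 v ->
  consistent v1 P -> consistent v (split_classes G2 P).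
Proof.
move=> ord1 /injectiveP inj_v ref_v cns.
apply/forallP=> r; apply/forallP=> s; apply/forallP=> t; apply/implyP.
case/and4P=> rs st /same_class_split[cls eq2].
have neq_ts : v t != v s by rewrite (inj_eq inj_v) -val_eqE neq_ltn st orbT.
(* Distinct vertices of one class share the second coordinate, hence differ in the first. *)
have neq_rs1 : (v r).1 != (v s).1.
  apply/eqP=> eq1; have /inj_v E : v r = v s.
    by rewrite [v r]surjective_pairing [v s]surjective_pairing eq1 eq2.
  by rewrite E ltnn in rs.
rewrite /sedge /= /hom_prod_rel neq_ts /= => /andP[_].
have [//|neq_ts1] := eqVneq (v t).1 (v s).1.
have [r1 vr] := ordering_surj v1 (v r).1 ord1.
have [s1 vs] := ordering_surj v1 (v s).1 ord1.
have [t1 vt] := ordering_surj v1 (v t).1 ord1.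
have lt_rs := refines_fst_lt _ _ _ _ _ _ ref_v rs vr vs neq_rs1.
have lt_st : s1 < t1.
  by apply: (refines_fst_lt _ _ _ _ _ _ ref_v st vs vt); rewrite eq_sym.
(* If [v t] and [v r] had the same first coordinate, then [t1 = r1], against [r1 < s1 < t1]. *)
case/orP=> [/eqP E|/andP[adj nadj]].
  have := ltn_trans lt_rs lt_st; have/injectiveP inj_v1 := ord1.
  by move: E; rewrite vr vt => /inj_v1->; rewrite ltnn.
(* Non-adjacency in [G2] passes from [v r] to [v s] by [eq2]; what remains is an adjacency in
   [G1]. *)
rewrite -eq2 nadj andbT vs vt.
move/forallP/(_ r1)/forallP/(_ s1)/forallP/(_ t1)/implyP: cns; apply.
by rewrite lt_rs lt_st -vr -vs cls -vt.
Qed.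

(** The second condition mirrors the first: now [v s] and [v t] share a class, so their first
    coordinates differ, and the outright adjacency is the one between [v s] and [v r]. *)
Lemma strongly_consistent_split {G1 G2 : sgraph} (v1 : {ffun 'I_#|G1| -> G1})
    (v : {ffun 'I_#|hom_prod G1 G2| -> hom_prod G1 G2}) (P : {set {set G1}}) :
  is_ordering v1 -> is_ordering v -> refines_fst v1 v ->
  strongly_consistent v1 P -> strongly_consistent v (split_classes G2 P).
Proof.
move=> ord1 ord ref_v /andP[cns scns]; rewrite /strongly_consistent.
rewrite (consistent_split v1) //=; have /injectiveP inj_v := ord.
apply/forallP=> r; apply/forallP=> s; apply/forallP=> t; apply/implyP.
case/and4P=> rs st /same_class_split[cls eq2].
have neq_sr : v s != v r by rewrite (inj_eq inj_v) -val_eqE neq_ltn rs orbT.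
have neq_st1 : (v s).1 != (v t).1.
  apply/eqP=> eq1; have /inj_v E : v s = v t.
    by rewrite [v s]surjective_pairing [v t]surjective_pairing eq1 eq2.
  by rewrite E ltnn in st.
rewrite /sedge /= /hom_prod_rel neq_sr /= => /andP[_].
have [//|neq_sr1] := eqVneq (v s).1 (v r).1.
have [r1 vr] := ordering_surj v1 (v r).1 ord1.
have [s1 vs] := ordering_surj v1 (v s).1 ord1.
have [t1 vt] := ordering_surj v1 (v t).1 ord1.
have lt_st := refines_fst_lt _ _ _ _ _ _ ref_v st vs vt neq_st1.
have lt_rs : r1 < s1.
  by apply: (refines_fst_lt _ _ _ _ _ _ ref_v rs vr vs); rewrite eq_sym.
case/orP=> [/eqP E|/andP[adj nadj]].
  have := ltn_trans lt_rs lt_st; have/injectiveP inj_v1 := ord1.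
  by move: E; rewrite vr vt => /inj_v1->; rewrite ltnn.
rewrite eq2 nadj andbT vs vr.
move/forallP/(_ r1)/forallP/(_ s1)/forallP/(_ t1)/implyP: scns; apply.
by rewrite lt_rs lt_st -vs -vt cls -vr.
Qed.

(** Inside [C * {w}] an edge would need equal first coordinates, which makes its two ends the same
    vertex. *)
Lemma independent_split {G1 G2 : sgraph} (C : {set G1}) (w : G2) :
  @independent G1 C -> @independent (hom_prod G1 G2) (setX C [set w]).
Proof.
move=> /forall_inP indC; apply/forall_inP=> -[x a]; rewrite inE /= => /andP[xC /set1P->].
apply/forall_inP=> -[y b]; rewrite inE /= => /andP[yC /set1P->].
have /forall_inP/(_ y yC)/negbTE nadj := indC x xC.
by rewrite /sedge /= /hom_prod_rel /= nadj orbF xpair_eqE eqxx andbT andNb.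
Qed.

(** Since [w] is not adjacent to itself, the condition on [G2] always holds, and adjacency of
    distinct first coordinates in [C] suffices. *)
Lemma clique_split {G1 G2 : sgraph} (C : {set G1}) (w : G2) :
  @clique G1 C -> @clique (hom_prod G1 G2) (setX C [set w]).
Proof.
move=> /forall_inP clqC; apply/forall_inP=> -[x a]; rewrite inE /= => /andP[xC /set1P->].
apply/forall_inP=> -[y b]; rewrite inE /= => /andP[yC /set1P->].
apply/implyP=> neq; rewrite /sedge /= /hom_prod_rel neq /= sedge_irrefl andbT.
have /forall_inP/(_ y yC) := clqC x xC.
by case: eqVneq.
Qed.

(** Abstracting the ordering condition and the class condition lets one argument serve all six
    parameters. *)
Lemma has_partition_hom_prod {G1 G2 : sgraph}
    (cns : {ffun 'I_#|G1| -> G1} -> {set {set G1}} -> bool)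
    (cns' : {ffun 'I_#|hom_prod G1 G2| -> hom_prod G1 G2} ->
            {set {set hom_prod G1 G2}} -> bool)
    (cls : {set G1} -> bool) (cls' : {set hom_prod G1 G2} -> bool) (k : nat) :
  (forall v1 v P, is_ordering v1 -> is_ordering v -> refines_fst v1 v ->
     cns v1 P -> cns' v (split_classes G2 P)) ->
  (forall C (w : G2), cls C -> cls' (setX C [set w])) ->
  @has_partition G1 cns cls k ->
  exists2 k', k' <= k * #|G2| & @has_partition (hom_prod G1 G2) cns' cls' k'.
Proof.
move=> cnsS clsS /existsP[v1 /existsP[P /and5P[ord1 partP cnsP /forall_inP clsP /eqP<-]]].
have [v ord ref_v] := exists_refining_ordering G1 G2 v1 ord1.
exists #|split_classes G2 P|; first exact: card_split_classes.
apply/existsP; exists v; apply/existsP; exists (split_classes G2 P).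
rewrite ord partition_split_classes // (cnsS v1) // eqxx andbT /=.
by apply/forall_inP=> _ /split_classesP[C [w [PC ->]]]; apply/clsS/clsP.
Qed.

Lemma ex_minn_hom_prod {G1 G2 : sgraph}
    (cns : {ffun 'I_#|G1| -> G1} -> {set {set G1}} -> bool)
    (cns' : {ffun 'I_#|hom_prod G1 G2| -> hom_prod G1 G2} ->
            {set {set hom_prod G1 G2}} -> bool)
    (cls : {set G1} -> bool) (cls' : {set hom_prod G1 G2} -> bool)
    (ex1 : exists k, @has_partition G1 cns cls k)
    (ex : exists k, @has_partition (hom_prod G1 G2) cns' cls' k) :
  (forall v1 v P, is_ordering v1 -> is_ordering v -> refines_fst v1 v ->
     cns v1 P -> cns' v (split_classes G2 P)) ->
  (forall C (w : G2), cls C -> cls' (setX C [set w])) ->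
  ex_minn ex <= ex_minn ex1 * #|G2|.
Proof.
move=> cnsS clsS; case: (ex_minnP ex1) => k hk _; case: ex_minnP => m _ min_m.
have [k' le_k' /min_m le_m] := has_partition_hom_prod _ _ _ _ _ cnsS clsS hk.
exact: leq_trans le_m le_k'.
Qed.

Theorem theorem4p49 (G1 G2 : sgraph) :
  [/\ thin (hom_prod G1 G2) <= thin G1 * #|G2|,
      pthin (hom_prod G1 G2) <= pthin G1 * #|G2| &
      compthin (hom_prod G1 G2) <= compthin G1 * #|G2|] /\
  [/\ comppthin (hom_prod G1 G2) <= comppthin G1 * #|G2|,
      indthin (hom_prod G1 G2) <= indthin G1 * #|G2| &
      indpthin (hom_prod G1 G2) <= indpthin G1 * #|G2|].
Proof.
by split; split; apply: ex_minn_hom_prod => //;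
  solve [exact: consistent_split | exact: strongly_consistent_split
        | exact: independent_split | exact: clique_split].
Qed.
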